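(* Let $\mathcal{C}\subset \mathbb{Z}_7^3$ be the classical single-error-correcting code in the $7^3$ cubic lattice, i.e. the subgroup of $\mathbb{Z}_7^3$ generated by the vectors $(0,1,4)$ and $(1,0,2)$ modulo $7$ (its elements are the $49$ codewords). Then $\mathcal{C}$ can be characterized as a lattice code: there is a lattice $\Lambda$ with $\mathbb{Z}^3\supset \Lambda\supset 7\mathbb{Z}^3$ such that reduction of coordinates modulo $7$ induces a group isomorphism from the lattice code $\Lambda/7\mathbb{Z}^3$ onto $\mathcal{C}$.
   Context: $\mathbb{Z}_7=\mathbb{Z}/7\mathbb{Z}$. The $7^3$ cubic lattice is $\mathbb{Z}_7^3$, whose points correspond to the unit cubes of a $7\times7\times7$ cube with opposite faces identified. An $n$-dimensional lattice is the set of all integer combinations of a basis of $\mathbb{R}^n$. If $\Lambda'\subset\Lambda$ are $n$-dimensional lattices, the set of cosets of $\Lambda'$ in $\Lambda$ (the quotient group $\Lambda/\Lambda'$) is called a lattice code. *)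

(* Defs.v *)
From mathcomp Require Import all_boot all_order all_algebra all_fingroup.
From mathcomp Require Import all_classical all_reals.

Set Implicit Arguments.
Unset Strict Implicit.
Unset Printing Implicit Defensive.

Import Order.TTheory GRing.Theory Num.Theory.

Local Open Scope classical_set_scope.
Local Open Scope ring_scope.

Definition is_lattice (R : realType) (n : nat) (L : set 'rV[R]_n) : Prop :=
  exists b : n.-tuple 'rV[R]_n,
    basis_of fullv b /\
    L = range (fun k : 'I_n -> int => \sum_(i < n) (k i)%:~R *: tnth b i).

Definition intvec (R : realType) (n : nat) (v : 'rV[int]_n) : 'rV[R]_n :=
  map_mx intr v.

Definition Zn (R : realType) (n : nat) : set 'rV[R]_n := range (@intvec R n).
Arguments Zn : clear implicits.

Definition scaled_Zn (R : realType) (n q : nat) : set 'rV[R]_n :=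
  [set q%:R *: x | x in Zn R n].
Arguments scaled_Zn : clear implicits.

Definition coset_at (R : realType) (n : nat) (L' : set 'rV[R]_n)
    (x : 'rV[R]_n) : set 'rV[R]_n :=
  [set x + y | y in L'].

Definition lattice_code (R : realType) (n : nat) (L L' : set 'rV[R]_n) :
    set (set 'rV[R]_n) :=
  [set coset_at L' x | x in L].

(* On cosets of an additive subgroup, the Minkowski sum is the group law of the
   quotient. *)
Definition coset_add (R : realType) (n : nat) (A B : set 'rV[R]_n) :
    set 'rV[R]_n :=
  [set x + y | x in A & y in B].

Definition mod7 (n : nat) (v : 'rV[int]_n) : 'rV['Z_7]_n := map_mx intr v.

(* The group structure of 'rV['Z_7]_3 as a finGroupType is the additive one, so
   << _ >> is the additive subgroup generated by the two rows. *)
Definition code7 : {set 'rV['Z_7]_3} :=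
  <<[set (\row_j [:: 0; 1; 4]`_j)%R; (\row_j [:: 1; 0; 2]`_j)%R]%SET>>%g.

(* phi is only relevant on the cosets making up L / L', where it has to be the
   map sending the class of an integer vector v to v mod 7. *)
Definition mod7_induces_isom (R : realType) (n : nat) (L L' : set 'rV[R]_n)
    (C : {set 'rV['Z_7]_n}) : Prop :=
  exists phi : set 'rV[R]_n -> 'rV['Z_7]_n,
    [/\ forall v : 'rV[int]_n,
          L (intvec R v) -> phi (coset_at L' (intvec R v)) = mod7 v,
        forall A B, lattice_code L L' A -> lattice_code L L' B ->
          phi (coset_add A B) = phi A + phi B
      & set_bij (lattice_code L L') [set` C] phi].

(* Main.v *)
(** Take for the lattice the integer vectors whose reduction modulo 7 lies in
    the code.  Two integer vectors have the same coset modulo 7Z^n exactly when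
    they have the same reduction, so reduction descends to an isomorphism of
    the quotient onto the code, for any subgroup C of (Z/7)^n.  For the given
    code this preimage is the Z-span of the independent vectors (0,1,4),
    (1,0,2), (0,0,7). *)
Require Import Defs.
From mathcomp Require Import all_boot all_order all_algebra all_fingroup.
From mathcomp Require Import all_classical all_reals.
From mathcomp Require Import ring.

Set Implicit Arguments.
Unset Strict Implicit.
Unset Printing Implicit Defensive.

Import GRing.Theory Num.Theory.

Local Open Scope classical_set_scope.
Local Open Scope ring_scope.

Section Reduction.
Variables (R : realType) (n : nat).
Implicit Types (v w u : 'rV[int]_n) (C : {group 'rV['Z_7]_n}).

Lemma intvec_inj : injective (@intvec R n).
Proof.
move=> v w /rowP vw; apply/rowP => j.
by have := vw j; rewrite !mxE => /intr_inj.
Qed.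

Lemma intvecD v w : intvec R (v + w) = intvec R v + intvec R w.
Proof. exact: map_mxD. Qed.

Lemma intvecZ (k : nat) v : intvec R (k%:R *: v) = k%:R *: intvec R v.
Proof. by apply/rowP => j; rewrite !mxE rmorphM rmorph_nat. Qed.

Lemma mod7D v w : mod7 (v + w) = mod7 v + mod7 w.
Proof. exact: map_mxD. Qed.

Lemma intr_Z7_eq0 (a : int) : (a%:~R == 0 :> 'Z_7) = (7 %| a)%Z.
Proof. by rewrite (@dvdz_pcharf 'Z_7 7). Qed.

(** Entrywise, equal residues mean a difference divisible by 7; the quotients form [u]. *)
Lemma mod7_eqP v w : mod7 v = mod7 w <-> exists u, v = w + 7 *: u.
Proof.
split=> [/rowP vw | [u ->]].
  have dvd7 j : exists a : int, v 0 j - w 0 j = a * 7.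
    apply/dvdzP; rewrite -intr_Z7_eq0 rmorphB /= subr_eq0.
    by have := vw j; rewrite !mxE => ->.
  have [f fP] := choice dvd7.
  exists (\row_j f j); apply/rowP => j.
  by rewrite !mxE mulrC -fP addrC subrK.
apply/rowP => j; rewrite !mxE rmorphD rmorphM /=.
by rewrite (_ : (7 : int)%:~R = 0 :> 'Z_7) ?mul0r ?addr0 //; apply: val_inj.
Qed.

Lemma mod7_surj (x : 'rV['Z_7]_n) : exists v, mod7 v = x.
Proof.
exists (\row_j (x 0 j : nat)%:Z); apply/rowP => j; rewrite !mxE.
exact: natr_Zp.
Qed.

(** The coset of an integer vector is a fibre of [mod7] embedded in the real space, so questions
    about cosets become questions about residues. *)
Lemma coset_atE v x :
  coset_at (scaled_Zn R n 7) (intvec R v) x <->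
  exists2 w, mod7 w = mod7 v & x = intvec R w.
Proof.
split=> [[_ [_ [u _ <-] <-] <-] | [w /mod7_eqP[u ->] ->]].
  exists (v + 7 *: u); first by apply/mod7_eqP; exists u.
  by rewrite intvecD intvecZ.
exists (7%:R *: intvec R u); last by rewrite intvecD intvecZ.
by exists (intvec R u) => //; exists u.
Qed.

Lemma eq_coset_at v w :
  coset_at (scaled_Zn R n 7) (intvec R v) =
  coset_at (scaled_Zn R n 7) (intvec R w) <-> mod7 v = mod7 w.
Proof.
split=> [vw | vw].
  have : coset_at (scaled_Zn R n 7) (intvec R v) (intvec R v).
    by apply/coset_atE; exists v.
  by rewrite vw => /coset_atE[u <- /intvec_inj ->].
by apply/seteqP; split=> x /coset_atE[u e ->]; apply/coset_atE; exists u;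
  rewrite ?e.
Qed.

Lemma coset_addE v w :
  coset_add (coset_at (scaled_Zn R n 7) (intvec R v))
            (coset_at (scaled_Zn R n 7) (intvec R w)) =
  coset_at (scaled_Zn R n 7) (intvec R (v + w)).
Proof.
apply/seteqP; split=> [_ [_ /coset_atE[v' ev ->]] [_ /coset_atE[w' ew ->]] <- |].
  by apply/coset_atE; exists (v' + w'); rewrite ?mod7D ?ev ?ew ?intvecD.
move=> _ /coset_atE[u eu ->].
(* Keep [v] itself as first summand; [u - v] then has the residue of [w] by cancellation. *)
exists (intvec R v); first by apply/coset_atE; exists v.
exists (intvec R (u - v)); last by rewrite -intvecD addrC subrK.
apply/coset_atE; exists (u - v) => //.
by apply: (addrI (mod7 v)); rewrite -!mod7D -eu addrC subrK.
Qed.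

Definition mod7_preim (C : {set 'rV['Z_7]_n}) : set 'rV[R]_n :=
  [set intvec R v | v in [set v | mod7 v \in C]].

Lemma mod7_preim_induces_isom C :
  mod7_induces_isom (mod7_preim C) (scaled_Zn R n 7) C.
Proof.
(* [phi] reduces a chosen integer representative of the coset. The default 0 is only reached on sets
   that are not cosets of integer vectors, and [phiE] shows that the choice does not matter. *)
pose phi A :=
  mod7 (xget 0 [set v | A = coset_at (scaled_Zn R n 7) (intvec R v)]).
have phiE v : phi (coset_at (scaled_Zn R n 7) (intvec R v)) = mod7 v.
  rewrite /phi; case: xgetP => [u _ /= /eq_coset_at -> // | /(_ v)].
  by case.
exists phi; split=> [v _ | A B | ]; first exact: phiE.
  move=> [_ [v _ <-] <-] [_ [w _ <-] <-].
  by rewrite coset_addE !phiE mod7D.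
split=> [_ [_ [v Cv <-] <-] | A B | x /= Cx].
- by rewrite /= phiE.
- rewrite !inE => -[_ [v _ <-] <-] [_ [w _ <-] <-].
  by rewrite !phiE => /eq_coset_at.
have [v vx] := mod7_surj x.
exists (coset_at (scaled_Zn R n 7) (intvec R v)); last by rewrite phiE.
by exists (intvec R v) => //; exists v; rewrite //= vx.
Qed.

Lemma scaled_Zn_sub_preim C : scaled_Zn R n 7 `<=` mod7_preim C.
Proof.
move=> _ [_ [u _ <-] <-]; exists (7 *: u); last exact: intvecZ.
rewrite /=.
have -> : mod7 (7 *: u) = mod7 0 by apply/mod7_eqP; exists u; rewrite add0r.
(* The identity of the finite group on row vectors is the zero vector. *)
by rewrite [mod7 0]raddf0; apply: group1.
Qed.

(** A nonzero integer determinant stays nonzero in [R], so the rows of [B] are [n] free vectors in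
    dimension [n], hence a basis. *)
Lemma is_lattice_row_span (B : 'M[int]_n) :
  \det B != 0 -> is_lattice [set intvec R (k *m B) | k in [set: 'rV_n]].
Proof.
move=> detB; pose b := [tuple row i (map_mx intr B : 'M[R]_n) | i < n].
have tnth_b i : tnth b i = row i (map_mx intr B) by rewrite tnth_mktuple.
exists b; split.
  rewrite basisEfree subvf dimvf dim_matrix size_tuple mul1r leqnn !andbT.
  apply/freeP => k k0 i.
  have uB : (map_mx intr B : 'M[R]_n) \in unitmx.
    by rewrite unitmxE (det_map_mx intr) unitfE intr_eq0.
  (* A vanishing combination of the rows is a vector times [B]; multiplying by the inverse kills its
     coefficients. *)
  have /(congr1 (mulmx^~ (invmx (map_mx intr B)))) :
      \row_i k i *m map_mx intr B = 0.
    rewrite mulmx_sum_row -{}[RHS]k0; apply: eq_bigr => j _.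
    by rewrite mxE -tnth_nth tnth_b.
  by rewrite /= mulmxK // mul0mx => /rowP/(_ i); rewrite !mxE.
have E (k : 'rV[int]_n) :
    intvec R (k *m B) = \sum_i (k 0 i)%:~R *: tnth b i.
  rewrite /intvec (map_mxM intr) mulmx_sum_row; apply: eq_bigr => i _.
  by rewrite mxE tnth_b.
apply/seteqP; split=> _ [k _ <-]; first by exists (k 0).
by exists (\row_i k i) => //; rewrite E; apply: eq_bigr => i _; rewrite mxE.
Qed.

Lemma is_lattice_scaled_Zn q : (0 < q)%N -> is_lattice (scaled_Zn R n q).
Proof.
move=> q0; suff -> : scaled_Zn R n q =
    [set intvec R (k *m q%:R%:M) | k in [set: 'rV_n]].
  by apply: is_lattice_row_span; rewrite det_scalar expf_neq0 // pnatr_eq0 -lt0n.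
have E (k : 'rV[int]_n) : intvec R (k *m q%:R%:M) = q%:R *: intvec R k.
  by rewrite -intvecZ; congr intvec; apply: mul_mx_scalar.
apply/seteqP; split=> [_ [_ [k _ <-] <-] | _ [k _ <-]]; first by exists k.
by rewrite E; exists (intvec R k) => //; exists k.
Qed.

End Reduction.

Arguments mod7_preim R {n} C.

Definition gen1 : 'rV['Z_7]_3 := \row_j [:: 0; 1; 4]`_j.
Definition gen2 : 'rV['Z_7]_3 := \row_j [:: 1; 0; 2]`_j.

Definition codeword (x : 'Z_7 * 'Z_7) := x.1 *: gen1 + x.2 *: gen2.

(** The codeword of [(a, b)] is [(b, a, 4a + 2b)], so its first two coordinates recover the pair. *)
Lemma codeword_inj : injective codeword.
Proof.
move=> [a b] [c d] /rowP E.
have := E 1; have := E 0; rewrite !mxE /= !(mulr0, mulr1, add0r, addr0).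
by move=> -> ->.
Qed.

Lemma code7E : code7 = [set codeword x | x in [set: 'Z_7 * 'Z_7]%SET]%SET.
Proof.
apply/eqP; rewrite finset.eqEsubset; apply/andP; split.
  have gC : group_set [set codeword x | x in [set: 'Z_7 * 'Z_7]%SET]%SET.
    apply/group_setP; split.
      by apply/imsetP; exists (0, 0); rewrite ?inE // /codeword !scale0r addr0.
    move=> _ _ /imsetP[x _ ->] /imsetP[y _ ->].
    apply/imsetP; exists (x + y); rewrite ?inE // FinRing.zmodMgE /codeword.
    by rewrite !scalerDl addrACA.
  rewrite (gen_subG _ (Group gC)).
  apply/fintype.subsetP => _ /set2P[] ->; apply/imsetP.
    by exists (1, 0); rewrite ?inE // /codeword scale1r scale0r addr0.
  by exists (0, 1); rewrite ?inE // /codeword scale1r scale0r add0r.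
apply/fintype.subsetP => _ /imsetP[[a b] _ ->].
(* With scalars written as natural numbers, scaling is repeated addition, that is, a power in the
   group. *)
rewrite /codeword /= -(natr_Zp a) -(natr_Zp b) !scaler_nat.
rewrite -!FinRing.zmodXgE -FinRing.zmodMgE.
by rewrite groupM // groupX // mem_gen // !inE eqxx ?orbT.
Qed.

Lemma card_code7 : #|code7| = 49%N.
Proof.
by rewrite code7E card_imset ?cardsT ?card_prod ?card_ord //; apply: codeword_inj.
Qed.

(** The generators lifted to integers, completed by [(0, 0, 7)], which accounts for the third
    coordinate being fixed only modulo 7. *)
Definition lattice_basis7 : 'M[int]_3 :=
  \matrix_(i, j) (nth [::] [:: [:: 0; 1; 4]; [:: 1; 0; 2]; [:: 0; 0; 7]] i)`_j.

Lemma det_lattice_basis7 : \det lattice_basis7 = - 7.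
Proof.
do 2! rewrite !(expand_det_row _ ord0) !big_ord_recl !big_ord0 /cofactor.
by rewrite !det_mx11 !mxE.
Qed.

Lemma mod7_preim_code7 (R : realType) :
  mod7_preim R code7 =
  [set intvec R (k *m lattice_basis7) | k in [set: 'rV_3]].
Proof.
have E (k : 'rV[int]_3) : k *m lattice_basis7 =
    \row_j [:: k 0 1; k 0 0; 4 * k 0 0 + 2 * k 0 1 + 7 * k 0 2]`_j.
  apply/rowP => j; rewrite !mxE !big_ord_recl big_ord0 !mxE.
  have -> : lift ord0 (lift ord0 ord0) = 2 :> 'I_3 by apply/val_inj.
  have -> : lift ord0 ord0 = 1 :> 'I_3 by apply/val_inj.
  by case: j => -[|[|[|//]]] ?; rewrite /=; ring.
apply/seteqP; split=> [_ [v /= Cv <-] | _ [k _ <-]].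
  move: Cv; rewrite code7E => /imsetP[[a b] _ /rowP vE].
  (* The check equation of the code: modulo 7, the first two coordinates determine the third. *)
  have : (7 %| (v 0 2 - (4 * v 0 1 + 2 * v 0 0))%R)%Z.
    rewrite -intr_Z7_eq0.
    have := vE 0; have := vE 1; have := vE 2.
    rewrite !mxE /= !(mulr0, mulr1, add0r, addr0) => v2 v1 v0.
    rewrite rmorphB rmorphD !rmorphM /= v0 v1 v2; apply/eqP; ring.
  move=> /dvdzP[c cE].
  (* The coefficients of the generators are the first two coordinates, swapped; the quotient [c]
     corrects the third. *)
  exists (\row_j [:: v 0 1; v 0 0; c]`_j) => //; congr intvec.
  rewrite E; apply/rowP => j; rewrite !mxE /=.
  case: j => -[|[|[|//]]] lt3 /=; try by congr (v 0 _); apply/val_inj.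
  by rewrite [7 * c]mulrC -cE addrC subrK; congr (v 0 _); apply/val_inj.
exists (k *m lattice_basis7) => //=; rewrite code7E.
apply/imsetP; exists ((k 0 0)%:~R, (k 0 1)%:~R) => //.
rewrite E; apply/rowP => j; rewrite !mxE /=.
case: j => -[|[|[|//]]] lt3 /=.
- by rewrite mulr0 mulr1 add0r.
- by rewrite mulr0 mulr1 addr0.
rewrite !rmorphD !rmorphM /= (_ : (7 : int)%:~R = 0 :> 'Z_7) ?mul0r ?addr0.
  by rewrite ![(k 0 _)%:~R * _]mulrC.
exact: val_inj.
Qed.

Theorem theorem1 (R : realType) :
  #|code7| = 49%N /\
  exists L : set 'rV[R]_3,
    [/\ is_lattice L,
        is_lattice (scaled_Zn R 3 7),
        scaled_Zn R 3 7 `<=` L,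
        L `<=` Zn R 3
      & mod7_induces_isom L (scaled_Zn R 3 7) code7].
Proof.
split; first exact: card_code7.
exists (mod7_preim R code7); split.
- rewrite mod7_preim_code7; apply: is_lattice_row_span.
  by rewrite det_lattice_basis7.
- exact: is_lattice_scaled_Zn.
- exact: scaled_Zn_sub_preim.
- by move=> _ [v _ <-]; exists v.
- exact: mod7_preim_induces_isom.
Qed.
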